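(* Let $n\ge1$, $N=(N_1,\dots,N_n)\in\mathbb{N}^n$, let $p>2$ be an integer, let $P(\partial_z)$ ($z\in\mathbb{C}^n$) be a quasi-homogeneous operator of type $N$ and of order $p$, and let $m$ be a function of order $p$. Then the series $$\sum_{j=0}^{\infty}\frac{P^j(\partial_z)\varphi(z)}{m(j)}t^{pj}$$ is not an $N$-generalised integral mean for any Borel measure $\mu$ of compact support in $\mathbb{R}^n$; that is, there is no finite complex Borel measure $\mu$ on $\mathbb{R}^n$ with compact support such that $M^N_\mu(\varphi;z,t)=\sum_{j\ge0}\frac{P^j(\partial_z)\varphi(z)}{m(j)}t^{pj}$ for all $\varphi$ holomorphic in a neighbourhood of the origin in $\mathbb{C}^n$ (and all $(z,t)$ near the origin).
   Context: A polynomial $P(\zeta)$, $\zeta\in\mathbb{C}^n$ (resp. operator $P(\partial_z)$ with constant coefficients) is quasi-homogeneous of type $N$ and order $p$ if $P(\zeta)=\sum a_k\zeta^k\not\equiv0$ where the sum runs over multi-indices $k\in\mathbb{N}_0^n$ with $k_1N_1+\dots+k_nN_n=p$. A function of order $p>0$ is a function $m$ on $\mathbb{N}_0$ with $c^j\Gamma(1+pj)\le m(j)\le C^j\Gamma(1+pj)$ for all $j$, for some $c,C>0$. For a finite complex Borel measure $\mu$ on $\mathbb{R}^n$ with compact support, the $N$-generalised integral mean is $M^N_\mu(\varphi;z,t)=\int_{\mathbb{R}^n}\varphi(z+t^Ny)\,d\mu(y)$, where $t^Ny:=(t^{N_1}y_1,\dots,t^{N_n}y_n)$. *)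

(* Defs.v *)
From HB Require Import structures.
From mathcomp Require Import all_boot all_order all_algebra.
From mathcomp Require Import all_classical all_reals all_analysis.
From mathcomp Require Import complex.
Set Implicit Arguments. Unset Strict Implicit. Unset Printing Implicit Defensive.
Import Order.TTheory GRing.Theory Num.Theory.
Import numFieldNormedType.Exports.
Local Open Scope classical_set_scope.
Local Open Scope ring_scope.

Section Defs.
Variable R : realType.
Local Notation C := (R[i]).

Definition BorelRn (n : nat) := g_sigma_algebraType (@open 'rV[R]_n).

Definition pderiv (n : nat) (i : 'I_n) (f : 'rV[C]_n -> C) : 'rV[C]_n -> C :=
  fun z => derive (f : 'rV[C]_n -> C^o) z (delta_mx 0 i).

Definition dmono (n : nat) (k : 'I_n -> nat) (f : 'rV[C]_n -> C) : 'rV[C]_n -> C :=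
  foldr (fun i g => iter (k i) (@pderiv n i) g) f (enum 'I_n).

(** A constant coefficient operator P(d_z) = sum_k a_k d^k, multi-indices
    k with entries <= p (which covers every k with k.N = p, since N_i >= 1). *)
Definition Pop (n p : nat) (a : {ffun 'I_n -> 'I_p.+1} -> C)
  (f : 'rV[C]_n -> C) : 'rV[C]_n -> C :=
  fun z => \sum_(k : {ffun 'I_n -> 'I_p.+1}) a k * dmono (fun i => nat_of_ord (k i)) f z.

Definition quasi_homogeneous (n : nat) (N : 'I_n -> nat) (p : nat)
  (a : {ffun 'I_n -> 'I_p.+1} -> C) : Prop :=
  (exists k, a k != 0) /\
  (forall k, a k != 0 -> (\sum_(i < n) (k i : nat) * N i)%N = p).

(** m is a function of order p: c^j Gamma(1+pj) <= m(j) <= C^j Gamma(1+pj),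
    with Gamma(1+pj) = (pj)!. *)
Definition order_fun (p : nat) (m : nat -> R) : Prop :=
  exists c Cc : R, 0 < c /\ 0 < Cc /\
    forall j : nat, c ^+ j * ((p * j)`!)%:R <= m j /\ m j <= Cc ^+ j * ((p * j)`!)%:R.

Definition holomorphic_near0 (n : nat) (phi : 'rV[C]_n -> C) : Prop :=
  exists U : set 'rV[C]_n, @open ('rV[C]_n : normedModType C) U /\ U 0 /\
    forall z : ('rV[C]_n : normedModType C), U z -> differentiable (phi : ('rV[C]_n : normedModType C) -> C^o) z.

(** A finite complex Borel measure mu = mu1 - mu2 + i (mu3 - mu4) (mu_k finite
    positive Borel measures; every finite complex measure is of this form by
    the Jordan decomposition); cintegral gives int_K f dmu. *)
Definition cintegral (n : nat)
  (mu1 mu2 mu3 mu4 : {finite_measure set (BorelRn n) -> \bar R})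
  (K : set 'rV[R]_n) (f : 'rV[R]_n -> C) : C :=
  let I (mu : {finite_measure set (BorelRn n) -> \bar R}) (g : 'rV[R]_n -> R) :=
      Rintegral mu K g in
  let fr := fun y => complex.Re (f y) in
  let fi := fun y => complex.Im (f y) in
  Complex (I mu1 fr - I mu2 fr - I mu3 fi + I mu4 fi)
          (I mu1 fi - I mu2 fi + I mu3 fr - I mu4 fr).

Definition tN (n : nat) (N : 'I_n -> nat) (t : R) (y : 'rV[R]_n) : 'rV[C]_n :=
  \row_i ((t ^+ N i * y 0 i)%:C)%C.

(** N-generalised integral mean M^N_mu(phi; z, t) = int phi(z + t^N y) dmu(y),
    mu being supported in K. *)
Definition gen_mean (n : nat) (N : 'I_n -> nat)
  (mu1 mu2 mu3 mu4 : {finite_measure set (BorelRn n) -> \bar R})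
  (K : set 'rV[R]_n) (phi : 'rV[C]_n -> C) (z : 'rV[C]_n) (t : R) : C :=
  cintegral mu1 mu2 mu3 mu4 K (fun y => phi (z + tN N t y)).

Definition series_term (n p : nat) (a : {ffun 'I_n -> 'I_p.+1} -> C) (m : nat -> R)
  (phi : 'rV[C]_n -> C) (z : 'rV[C]_n) (t : R) (j : nat) : C :=
  iter j (Pop a) phi z / (m j)%:C%C * (t%:C%C) ^+ (p * j).

End Defs.

(* Main.v *)
Require Import Defs.
From HB Require Import structures.
From mathcomp Require Import all_boot all_order all_algebra.
From mathcomp Require Import all_classical all_reals all_analysis.
From mathcomp Require Import complex.
From mathcomp Require Import zify ring lra.
Set Implicit Arguments. Unset Strict Implicit. Unset Printing Implicit Defensive.
Import Order.TTheory GRing.Theory Num.Theory.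
Import numFieldNormedType.Exports.
Local Open Scope classical_set_scope.
Local Open Scope ring_scope.

(** Test the identity at [z = 0] on [phi_L z = (1 + <xi, z> / L) ^ L] with
    [xi = i * eta], [eta] real and [w := P xi != 0]. Since [t ^ N y] is real,
    [|phi_L|] stays below [e] on the support of the measure as soon as [L] is
    large compared with [t], so the integral means are bounded uniformly in [t].
    On the other side, the series is the polynomial [sum_j b_(L,j) s ^ j / m j] in
    [s = t ^ p], where [b_(L,1)] tends to [w], [|b_(L,j)| <= W ^ j] and [m j] is at
    least [c ^ j (3 j)!]. It thus approximates an entire function of order at most
    [1/3 < 1/2] which is bounded on the half-line [s >= 0]; such a function is
    constant, which forces [w = 0]. *)

(** * Bounded power series with rapidly decreasing coefficients *)

(** Induction on the Horner form: writing [D] for the forward difference,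
    [D (q * 'X + c) = D q * ('X + 1) + q], and both terms have size at most that of [q]. *)
Lemma size_shift_sub (R : comNzRingType) (q : {poly R}) :
  (size ((q \Po ('X + 1%:P)) - q)%R <= (size q).-1)%N.
Proof.
elim/poly_ind: q => [|q c IH]; first by rewrite comp_poly0 subr0 size_poly0.
have [->|q0] := eqVneq q 0.
  by rewrite mul0r add0r comp_polyC subrr size_poly0.
rewrite size_MXaddC (negPf q0) /=.
rewrite comp_polyD comp_polyM comp_polyX comp_polyC.
have -> : (q \Po ('X + 1%:P)) * ('X + 1%:P) + c%:P - (q * 'X + c%:P) =
  ((q \Po ('X + 1%:P)) - q) * ('X + 1%:P) + q by ring.
apply: (leq_trans (size_polyD _ _)); rewrite geq_max leqnn andbT.
apply: (leq_trans (size_polyMleq _ _)); rewrite size_XaddC.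
rewrite addn2 /=; move: IH; move: q0; rewrite -size_poly_gt0.
by case: (size q) => //= s _; rewrite ltnS.
Qed.

(** The sum is, up to sign, the [n]-th finite difference of [q] at 0. Pascal's rule turns the sum of
    order [n.+1] for [q] into minus the sum of order [n] for its forward difference, whose degree is
    smaller. *)
Lemma alternating_binomial_sum (R : comNzRingType) (n : nat) (q : {poly R}) :
  (size q <= n)%N ->
  \sum_(i < n.+1) (-1) ^+ i * 'C(n, i)%:R * q.[i%:R] = 0.
Proof.
elim: n q => [|n IH] q.
  by rewrite leqn0 size_poly_eq0 => /eqP->; rewrite big_ord1 horner0 mulr0.
move=> sq; have := IH ((q \Po ('X + 1%:P)) - q).
have -> : (size ((q \Po ('X + 1%:P)) - q)%R <= n)%N.
  by apply: leq_trans (size_shift_sub q) _; case: (size q) sq.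
move=> /(_ isT) E.
rewrite big_ord_recl /= expr0 mul1r bin0 mul1r.
under eq_bigr => i _ do rewrite /bump /= add1n binS natrD mulrDr mulrDl.
rewrite big_split /= big_ord_recr /= bin_small // mulr0 mul0r addr0.
rewrite addrA.
have -> : q.[0] + \sum_(i < n) (-1) ^+ i.+1 * 'C(n, i.+1)%:R * q.[i.+1%:R] =
   \sum_(i < n.+1) (-1) ^+ i * 'C(n, i)%:R * q.[i%:R].
  by rewrite big_ord_recl /= expr0 bin0 !mul1r.
transitivity (- \sum_(i < n.+1) (-1) ^+ i * 'C(n, i)%:R *
  ((q \Po ('X + 1%:P)) - q).[i%:R]); last by rewrite E oppr0.
rewrite -sumrN -big_split; apply: eq_bigr => i _ /=.
rewrite hornerD hornerN horner_comp !hornerE -natr1 exprS; ring.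
Qed.

(** The coefficients increase up to the middle because [(j + 1) C(2J, j + 1) = (2J - j) C(2J, j)];
    symmetry handles the other half. *)
Lemma leq_bin_central (J i : nat) : ('C(2 * J, i) <= 'C(2 * J, J))%N.
Proof.
have H j : (j < J)%N -> ('C(2 * J, j) <= 'C(2 * J, j.+1))%N.
  move=> jJ; rewrite -(leq_pmul2l (ltn0Sn j)) mul_bin_left leq_mul2r.
  by apply/orP; right; lia.
have H2 d j : (j + d = J)%N -> ('C(2 * J, j) <= 'C(2 * J, J))%N.
  elim: d j => [|d IH] j jd; first by rewrite -jd addn0.
  by apply: (leq_trans (H j _)); [lia | apply: IH; lia].
have [iJ|Ji] := leqP i J; first by apply: (H2 (J - i)%N); lia.
have [i2|i2] := leqP i (2 * J); last by rewrite bin_small.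
by rewrite -bin_sub //; apply: (H2 (i - J)%N); lia.
Qed.

(** Each of the [2 * j] factors of [(3 * j)!] beyond [j!] is at least [j]. *)
Lemma expn_fact3 (j : nat) : (j`! * j ^ (2 * j) <= (3 * j)`!)%N.
Proof.
suff H d : (j`! * j ^ d <= (j + d)`!)%N by apply: (leq_trans (H _)); rewrite -mulSn.
elim: d => [|d IH]; first by rewrite muln1 addn0.
rewrite expnS addnS factS mulnCA leq_mul //; lia.
Qed.

Lemma sum_expfact_le (R : realType) (x : R) (n : nat) : 0 <= x ->
  \sum_(0 <= i < n) x ^+ i / i`!%:R <= expR x.
Proof.
move=> x0.
have homo : {homo series (exp_coeff x) : m k / (m <= k)%N >-> m <= k}.
  apply: nondecreasing_series => i _ _; rewrite exp_coeffE /=.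
  by rewrite mulr_ge0 ?invr_ge0 ?exprn_ge0.
apply: le_trans (nondecreasing_cvgn_le homo (is_cvg_series_exp_coeff x) n).
by apply: ler_sum => i _; rewrite exp_coeffE mulrC.
Qed.

Lemma sum_inv_sqr_le2 (R : realFieldType) (J : nat) :
  \sum_(k < J) (k.+1%:R ^+ 2)^-1 <= 2 :> R.
Proof.
case: J => [|J]; first by rewrite big_ord0.
(* The strengthened bound makes the induction go through, as in a telescoping sum. *)
suff H : \sum_(k < J.+1) (k.+1%:R ^+ 2)^-1 <= 2 - J.+1%:R^-1 :> R.
  by apply: (le_trans H); rewrite lerBlDr lerDl invr_ge0.
elim: J => [|J IH]; first by rewrite big_ord1 /=; lra.
rewrite big_ord_recr /=; apply: (le_trans (lerD IH (lexx _))).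
rewrite -(natr1 J.+1).
have : 0 < J.+1%:R :> R by [].
move: (J.+1%:R : R) => x x0; rewrite -subr_ge0.
have -> : 2 - (x + 1)^-1 - (2 - x^-1 + ((x + 1) ^+ 2)^-1) = (x * (x + 1) ^+ 2)^-1.
  by field; rewrite !lt0r_neq0 //; lra.
by rewrite invr_ge0 mulr_ge0 ?exprn_ge0; lra.
Qed.

(* The even polynomial [q (d (X - J)^2)] has degree less than 2J, so its finite
   difference of order 2J vanishes; the central term gives [q 0]. *)
Lemma horner0_le_squares (R : realFieldType) (q : {poly R}) (J : nat) (d : R) :
  (size q <= J)%N ->
  `|q.[0]| <= 2 * \sum_(k < J) `|q.[d * k.+1%:R ^+ 2]|.
Proof.
move=> sq.
pose h := q \Po (d *: ('X - J%:R%:P) ^+ 2).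
have sh : (size h <= 2 * J)%N.
  have [->|] := eqVneq h 0; first by rewrite size_poly0.
  rewrite -size_poly_gt0 => h0.
  have := size_comp_poly_leq q (d *: ('X - J%:R%:P) ^+ 2).
  have : (size (d *: ('X - J%:R%:P) ^+ 2) <= 3)%N.
    apply: (leq_trans (size_scale_leq _ _)).
    by rewrite size_exp_XsubC.
  rewrite -/h; move: sq.
  have q0 : q != 0 by apply: contraTneq h0; rewrite /h => ->; rewrite comp_poly0 size_poly0.
  move: q0; rewrite -size_poly_gt0; nia.
have hE (i : R) : h.[i] = q.[d * (i - J%:R) ^+ 2] by rewrite horner_comp !hornerE.
have C0 : 0 < 'C(2 * J, J)%:R :> R by rewrite ltr0n bin_gt0; lia.
have := alternating_binomial_sum sh.
rewrite (bigD1 (inord J)) //= inordK ?ltnS ?leq_pmull //.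
rewrite hE subrr expr0n mulr0 => /eqP.
rewrite addr_eq0 => /eqP /(congr1 Num.norm).
rewrite normrN !normrM normrX normrN1 expr1n mul1r (ger0_norm (ltW C0)) => E.
rewrite -(ler_pM2l C0) E.
apply: (le_trans (ler_norm_sum _ _ _)).
pose T i := if i == J then 0 else `|q.[d * (i%:R - J%:R) ^+ 2]|.
apply: (@le_trans _ _ (\sum_(i < (2 * J).+1) 'C(2 * J, J)%:R * T i)).
  rewrite big_mkcond; apply: ler_sum => i _ /=; rewrite /T.
  have -> : (i == inord J) = (i == J :> nat).
    by rewrite -val_eqE /= inordK // ltnS leq_pmull.
  case: (i == J :> nat) => /=; first by rewrite mulr0.
  rewrite !normrM normrX normrN1 expr1n mul1r hE normr_nat.
  by apply: ler_wpM2r => //; rewrite ler_nat leq_bin_central.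
rewrite -big_distrr /= ler_pM2l //.
(* The nodes on the two sides of [J] lie symmetrically at distances [1, ..., J]; each side
   contributes the sum once, hence the factor 2. *)
rewrite -(big_mkord xpredT T) (@big_cat_nat _ _ _ J.+1) //=; last lia.
rewrite big_nat_recr //= {2}/T eqxx addr0 mulr2n mulrDl !mul1r lerD //.
  rewrite big_mkord (reindex_inj rev_ord_inj) /=; apply: ler_sum => i _.
  rewrite /T ifF; last by apply/negP => /eqP; have := ltn_ord i; lia.
  rewrite natrB //.
  by have -> : (J%:R - i.+1%:R - J%:R) ^+ 2 = i.+1%:R ^+ 2 :> R by ring.
have -> : (2 * J).+1 = (J + J.+1)%N by lia.
rewrite -{1}[J.+1]add0n big_addn addnK big_mkord; apply: ler_sum => i _.
rewrite /T ifF; last by apply/negP => /eqP; lia.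
by rewrite addnS -addSn natrD addrK.
Qed.

(** Removing the constant term, dividing by [s] and truncating leaves a polynomial [q] of size at
    most [J] with [q 0 = r 1]. [horner0_le_squares] bounds it by its values at the nodes [d k^2],
    where [|q| <= 2M / (d k^2) + tail]; summing [1 / k^2] to at most 2 gives [8M / d]. *)
Lemma linear_coef_le (R : realFieldType) (r : nat -> R) (D J : nat) (d M : R) :
  (0 < J < D)%N -> 0 < d ->
  (forall s, 0 <= s <= d * J%:R ^+ 2 ->
     `|\sum_(0 <= j < D) r j * s ^+ j| <= M) ->
  `|r 1%N| <= 8 * M / d +
    2 * J%:R * \sum_(J.+1 <= j < D) `|r j| * (d * J%:R ^+ 2) ^+ j.-1.
Proof.
move=> /andP[J0 JD] d0 H.
set S := d * J%:R ^+ 2; set tail := \sum_(J.+1 <= j < D) _.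
have S0 : 0 <= S by rewrite mulr_ge0 ?exprn_ge0 // ltW.
pose q := \poly_(j < J) r j.+1.
have sq : (size q <= J)%N by apply: size_poly.
have q0 : q.[0] = r 1%N by rewrite horner_coef0 coef_poly J0.
(* Evaluation at [s = 0]. *)
have r0 : `|r 0%N| <= M.
  have := H 0; rewrite lexx S0 => /(_ isT).
  rewrite (@big_cat_nat _ _ _ 1) //=; last by lia.
  rewrite big_nat1 expr0 mulr1 big1_seq ?addr0 // => j /andP[_].
  by rewrite mem_index_iota => /andP[j1 _]; rewrite expr0n (gtn_eqF j1) mulr0.
have qs s : 0 < s <= S -> `|q.[s]| <= 2 * M / s + tail.
  move=> /andP[s0 sS].
  have /H : 0 <= s <= S by rewrite ltW.
  rewrite (@big_cat_nat _ _ _ J.+1) //= big_nat_recl //= expr0 mulr1.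
  have -> : \sum_(0 <= i < J) r i.+1 * s ^+ i.+1 = s * q.[s].
    rewrite horner_poly big_distrr big_mkord; apply: eq_bigr => i _ /=.
    by rewrite exprS mulrCA.
  set t := \sum_(_ <= i < D) _ => Hg.
  have ht : `|t| <= s * tail.
    apply: (le_trans (ler_norm_sum _ _ _)); rewrite big_distrr /=.
    rewrite !big_seq; apply: ler_sum => j; rewrite mem_index_iota => /andP[Jj _].
    case: j Jj => // j _ /=.
    rewrite normrM mulrCA ler_wpM2l // exprS normrM (gtr0_norm s0).
    by rewrite ler_pM2l // normrX (gtr0_norm s0) lerXn2r // ?nnegrE ltW.
  rewrite -(ler_pM2l s0) -{1}(gtr0_norm s0) -normrM.
  have -> : s * q.[s] = (r 0%N + s * q.[s] + t) - r 0%N - t by ring.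
  have -> : s * (2 * M / s + tail) = M + M + s * tail.
    by field; rewrite lt0r_neq0.
  by apply: (le_trans (ler_normB _ _)); apply: lerD => //;
     apply: (le_trans (ler_normB _ _)); apply: lerD.
rewrite -q0; apply: (le_trans (horner0_le_squares d sq)).
apply: (@le_trans _ _ (2 * \sum_(k < J) (2 * M / d * (k.+1%:R ^+ 2)^-1 + tail))).
  rewrite ler_pM2l //; apply: ler_sum => k _.
  rewrite -mulrA -invfM; apply: qs.
  rewrite mulr_gt0 ?exprn_gt0 //= ler_pM2l // lerXn2r ?nnegrE //.
  by rewrite ler_nat.
rewrite big_split /= -big_distrr /= sumr_const card_ord -[tail *+ J]mulr_natl mulrDr.
rewrite [2 * (J%:R * _)]mulrA lerD2r mulrA.
have M0 : 0 <= M by apply: le_trans r0.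
have := sum_inv_sqr_le2 R J => /(ler_wpM2l (x := 2 * (2 * M / d))) h.
apply: le_trans (h _) _; last by lra.
by rewrite !mulr_ge0 ?invr_ge0 // ltW.
Qed.

(* Quantitative form of the fact that an entire function of order < 1/2 which is
   bounded on a half-line is constant. *)
Lemma linear_coef_cvg0 (R : realType) (r : nat -> nat -> R) (V W M : R) :
  0 <= V -> 0 <= W ->
  (forall L j, `|r L j| <= V * W ^+ j / (3 * j)`!%:R) ->
  (forall S, exists L0, forall L, (L0 <= L)%N -> exists D0, forall D, (D0 <= D)%N ->
     forall s, 0 <= s <= S -> `|\sum_(0 <= j < D) r L j * s ^+ j| <= M) ->
  forall e : R, 0 < e -> exists L0, forall L, (L0 <= L)%N -> `|r L 1%N| <= e.
Proof.
move=> V0 W0 rle H e e0.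
have M0 : 0 <= M.
  have [L /(_ L (leqnn _)) [D /(_ D (leqnn _) 0)]] := H 0.
  by rewrite lexx => /(_ isT); apply: le_trans.
(* This spacing makes [8M / d] at most [e / 2]; the added 1 keeps it positive when [M = 0]. *)
pose d := 16 * M / e + 1.
have d0 : 0 < d by rewrite ltr_wpDl // !mulr_ge0 ?invr_ge0 // ltW.
pose E := expR (W * d).
have E0 : 0 <= E by apply: expR_ge0.
(* [J] is fixed before [L], large enough that the tail contribution [2VE / (dJ)] is at most
   [e / 2]. *)
pose J := (Num.truncn (4 * V * E / d / e)).+1.
have J0 : (0 < J)%N by [].
have JR : 0 < J%:R :> R by rewrite ltr0n.
have hJ : 4 * V * E / d / e < J%:R by apply: truncnS_gt.
have [L0 HL] := H (d * J%:R ^+ 2).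
exists L0 => L /HL[D0 HD].
pose D := (maxn D0 J.+1).
have JD : (0 < J < D)%N by rewrite J0 leq_max ltnSn orbT.
apply: (le_trans (linear_coef_le JD d0 (HD _ _))); first exact: leq_maxl.
have -> : e = e / 2 + e / 2 by field.
apply: lerD.
  rewrite ler_pdivrMr //.
  have -> : e / 2 * d = 8 * M + e / 2 by rewrite /d; field; rewrite lt0r_neq0.
  by rewrite lerDl divr_ge0 // ltW.
apply: (@le_trans _ _ (2 * J%:R * (V / (d * J%:R ^+ 2) * E))); last first.
  have -> : 2 * J%:R * (V / (d * J%:R ^+ 2) * E) = (2 * V * E / d) / J%:R.
    by field; rewrite !lt0r_neq0.
  rewrite ler_pdivrMr //.
  move: hJ; rewrite ltr_pdivrMr // => h; lra.
rewrite ler_pM2l ?mulr_gt0 //.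
apply: (@le_trans _ _ (V / (d * J%:R ^+ 2) * \sum_(0 <= j < D) (W * d) ^+ j / j`!%:R)); last first.
  apply: ler_wpM2l; first by rewrite divr_ge0 // ltW // mulr_gt0 // exprn_gt0.
  by apply: sum_expfact_le; rewrite mulr_ge0 // ltW.
rewrite (@big_cat_nat _ _ _ J.+1 0 D) //=.
rewrite mulrDr -[X in X <= _]add0r lerD //.
  rewrite mulr_ge0 //; first by rewrite divr_ge0 // ltW // mulr_gt0 // exprn_gt0.
  by apply: sumr_ge0 => j _; rewrite divr_ge0 // exprn_ge0 // mulr_ge0 // ltW.
rewrite big_distrr /= !big_seq; apply: ler_sum => j.
rewrite mem_index_iota => /andP[Jj _].
apply: (le_trans (ler_wpM2r _ (rle L j))).
  by rewrite exprn_ge0 // ltW // mulr_gt0 // exprn_gt0.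
have jf : 0 < (j`!)%:R :> R by rewrite ltr0n fact_gt0.
have dJ : 0 < d * J%:R ^+ 2 by rewrite mulr_gt0 ?exprn_gt0.
(* As [J < j], the factorial absorbs the powers [J^(2j)] coming from the largest node and still
   leaves a [j!] for the exponential series. This is where order below 1/2 matters. *)
have h3 : j`!%:R * (J%:R ^+ 2) ^+ j <= (3 * j)`!%:R :> R.
  rewrite -exprM -natrX -natrM ler_nat.
  apply: leq_trans (expn_fact3 j); rewrite leq_mul2l leq_exp2r //; last lia.
  by rewrite (ltnW Jj) orbT.
have jj : 0 < (j`!%:R * (J%:R ^+ 2) ^+ j) :> R by rewrite mulr_gt0 // exprn_gt0 // exprn_gt0.
have -> : V * W ^+ j / (3 * j)`!%:R * (d * J%:R ^+ 2) ^+ j.-1 =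
   (V / (d * J%:R ^+ 2)) * (W ^+ j * (d * J%:R ^+ 2) ^+ j / (3 * j)`!%:R).
  have -> : (d * J%:R ^+ 2) ^+ j = (d * J%:R ^+ 2) * (d * J%:R ^+ 2) ^+ j.-1.
    by rewrite -exprS prednK // (leq_trans _ Jj).
  have := lt0r_neq0 (lt_le_trans jj h3); have := lt0r_neq0 dJ.
  set x := d * _; set f := _%:R => x0 f0.
  by move: (W ^+ j) (x ^+ j.-1) => w y; field; rewrite x0 f0.
apply: ler_wpM2l; first by rewrite divr_ge0 // ltW.
rewrite ler_pdivrMr ?(lt_le_trans jj) //.
apply: le_trans (ler_wpM2l _ h3); last first.
  by rewrite divr_ge0 // exprn_ge0 // mulr_ge0 // ltW.
rewrite le_eqVlt; apply/orP; left; apply/eqP.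
by rewrite !exprMn; field; rewrite lt0r_neq0.
Qed.

(** * Non-vanishing at a natural point *)

(** Reduction modulo [B] identifies the lowest digits; cancelling them and dividing by [B] leaves
    shorter expansions. *)
Lemma base_expansion_inj (n B : nat) (k l : 'I_n -> nat) :
  (forall i, (k i < B)%N) -> (forall i, (l i < B)%N) ->
  (\sum_(i < n) k i * B ^ i = \sum_(i < n) l i * B ^ i)%N -> k =1 l.
Proof.
elim: n k l => [|n IH] k l kB lB; first by move=> _ [].
have B0 : (0 < B)%N by apply: leq_ltn_trans (kB ord0).
rewrite !big_ord_recl expn0 !muln1 => E.
have shift (u : 'I_n.+1 -> nat) :
    (\sum_(i < n) u (lift ord0 i) * B ^ bump 0 i =
     B * \sum_(i < n) u (lift ord0 i) * B ^ i)%N.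
  rewrite big_distrr; apply: eq_bigr => i _ /=.
  by rewrite /bump add1n expnS mulnCA.
move: E; rewrite !shift => E.
have k0 : k ord0 = l ord0.
  by move/(congr1 (modn^~ B)): E; rewrite /= ![(_ + B * _)%N]addnC ![(B * _)%N]mulnC !modnMDl !modn_small.
move: E; rewrite k0 => /addnI /eqP; rewrite eqn_pmul2l // => /eqP.
move=> /(IH (k \o lift ord0) (l \o lift ord0) (fun i => kB _) (fun i => lB _)) E.
by move=> i; case: (unliftP ord0 i) => [j ->|->] //; apply: E.
Qed.

Lemma exists_nat_nonroot (R : numDomainType) (q : {poly R}) :
  q != 0 -> exists x : nat, q.[x%:R] != 0.
Proof.
move=> q0; apply: contrapT => H.
have := @max_poly_roots _ q [seq i%:R | i <- iota 0 (size q)] q0.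
rewrite size_map size_iota ltnn => F; apply: notF; apply: F.
  apply/allP => _ /mapP[i _ ->]; rewrite /root.
  by apply: contrapT => /negP h; apply: H; exists i.
by rewrite map_inj_uniq ?iota_uniq // => i j /eqP; rewrite eqr_nat => /eqP.
Qed.

(* Kronecker substitution [eta_i = x ^ (p + 1) ^ i] reduces to one variable. *)
Lemma exists_nat_nonzero (R : numDomainType) (n p : nat)
    (a : {ffun 'I_n -> 'I_p.+1} -> R) k0 : a k0 != 0 ->
  exists eta : 'I_n -> nat, \sum_k a k * \prod_i (eta i)%:R ^+ k i != 0.
Proof.
move=> ak0.
pose e (k : {ffun 'I_n -> 'I_p.+1}) := (\sum_(i < n) k i * p.+1 ^ i)%N.
have e_inj k l : e k = e l -> k = l.
  move=> /base_expansion_inj E; apply/ffunP => i; apply: val_inj.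
  by apply: E => j; apply: ltn_ord.
pose q : {poly R} := \sum_k a k *: 'X^(e k).
(* Injectivity of [e] leaves [a k0] as the whole coefficient of ['X^(e k0)]. *)
have q0 : q != 0.
  apply: contraNneq ak0 => /(congr1 (fun u : {poly R} => u`_(e k0))).
  rewrite /q coef_sumMXn coef0 (big_pred1 k0) => [->//|k].
  by apply/eqP/eqP => [/e_inj|->].
have [x qx] := exists_nat_nonroot q0.
exists (fun i => x ^ (p.+1 ^ i))%N.
apply: contraNneq qx => <-; apply/eqP.
rewrite /q horner_sum; apply: eq_bigr => k _; rewrite hornerZ hornerXn.
by rewrite -prodrXr /=; congr (_ * _); apply: eq_bigr => i _; rewrite natrX -exprM mulnC.
Qed.

(** * Differential operators on ridge functions *)

Definition linform (K : numFieldType) (n : nat) (xi : 'I_n -> K) (z : 'rV[K]_n) : K :=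
  \sum_i xi i * z 0 i.

(** On such functions a constant coefficient operator acts through the one-variable profile [f]
    alone. *)
Definition ridge (K : numFieldType) (n : nat) (xi : 'I_n -> K) (f : {poly K})
  (z : 'rV[K]_n) : K := f.[linform xi z].

Lemma differentiable_linform (K : numFieldType) (n : nat) (xi : 'I_n -> K) (z : 'rV[K]_n) :
  differentiable (linform xi) z.
Proof.
have -> : linform xi = \sum_i (xi i *: (fun z : 'rV[K]_n => z 0 i) : 'rV[K]_n -> K^o).
  by apply/funext => w; rewrite /linform fct_sumE.
apply: differentiable_sum => i; apply: differentiableZ.
exact: differentiable_coord.
Qed.

Lemma ridgeMXaddC (K : numFieldType) (n : nat) (xi : 'I_n -> K) (q : {poly K}) c :
  ridge xi (q * 'X + c%:P) = ridge xi q * linform xi + cst c.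
Proof. by apply/funext => z; rewrite /ridge hornerMXaddC. Qed.

Lemma differentiable_ridge (K : numFieldType) (n : nat) (xi : 'I_n -> K) (f : {poly K})
  (z : 'rV[K]_n) : differentiable (ridge xi f) z.
Proof.
elim/poly_ind: f => [|q c IH].
  have -> : ridge xi 0 = cst 0 by apply/funext => w; rewrite /ridge horner0.
  exact: differentiable_cst.
rewrite ridgeMXaddC; apply: differentiableD; last exact: differentiable_cst.
by apply: differentiableM => //; apply: differentiable_linform.
Qed.

Lemma is_derive_linform (K : numFieldType) (n : nat) (xi : 'I_n -> K) (z v : 'rV[K]_n) :
  is_derive z v (linform xi : _ -> K^o) (linform xi v).
Proof.
have H : h^-1 *: ((linform xi \o shift z) (h *: v) - linform xi z) @[h --> 0^']
    --> (linform xi v : K^o).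
  (* By linearity the difference quotient is constant away from [h = 0]. *)
  apply: cvg_near_cst; near=> h.
  have h0 : h != 0 by near: h; exact: nbhs_dnbhs_neq.
  rewrite /linform /= -sumrB scaler_sumr; apply: eq_bigr => i _.
  by rewrite !mxE mulrDr addrK mulrCA scalerA mulVf ?scale1r.
split; first exact: (cvgP _ H).
exact: cvg_lim H.
Unshelve. all: by end_near. Qed.

Lemma is_derive_ridge (K : numFieldType) (n : nat) (xi : 'I_n -> K) (f : {poly K})
    (z v : 'rV[K]_n) :
  is_derive z v (ridge xi f : _ -> K^o) (ridge xi f^`() z * linform xi v).
Proof.
elim/poly_ind: f => [|q c IH].
  have -> : ridge xi 0 = cst 0 by apply/funext => w; rewrite /ridge horner0.
  by rewrite deriv0 /ridge horner0 mul0r; apply: is_derive_cst.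
rewrite ridgeMXaddC.
have := @is_derive_linform _ _ xi z v => Hl.
apply: is_derive_eq.
rewrite addr0 derivD derivM derivX derivC addr0 mulr1 /ridge !hornerE.
rewrite /GRing.scale /= -/(linform xi z); ring.
Qed.

Section RidgeOperators.
Variable R : realType.
Local Notation C := (R[i]).
Variables (n p : nat) (xi : 'I_n -> C) (a : {ffun 'I_n -> 'I_p.+1} -> C).

Lemma pderiv_ridge i f : pderiv i (ridge xi f) = ridge xi (xi i *: f^`()).
Proof.
apply/funext => z; rewrite /pderiv (@derive_val _ _ _ _ _ _ _ (is_derive_ridge _ _ _ _)).
rewrite /ridge hornerZ mulrC; congr (_ * _).
rewrite /linform (bigD1 i) //= mxE !eqxx mulr1 big1 ?addr0 // => j ji.
by rewrite mxE (negPf ji) andbF mulr0.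
Qed.

Lemma iter_pderiv_ridge i k f :
  iter k (@pderiv R n i) (ridge xi f) = ridge xi (xi i ^+ k *: f^`(k)).
Proof.
elim: k => [|k IH]; first by rewrite expr0 scale1r.
by rewrite iterS IH pderiv_ridge derivZ scalerA -exprS.
Qed.

(** The operator induced by [Pop a] on profiles: by the chain rule each [d^k] becomes [xi^k] times a
    derivative of order [|k|]. *)
Definition diffop (f : {poly C}) : {poly C} :=
  \sum_k (a k * \prod_i xi i ^+ k i) *: f^`(\sum_i k i).

Lemma dmono_ridge (k : 'I_n -> nat) f :
  dmono k (ridge xi f) = ridge xi ((\prod_i xi i ^+ k i) *: f^`(\sum_i k i)).
Proof.
rewrite /dmono -[\prod_i _]big_enum -[(\sum_i _)%N]big_enum /=.
elim: (enum _) => [|i s IH]; first by rewrite !big_nil scale1r.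
rewrite /= IH iter_pderiv_ridge !big_cons derivnZ scalerA.
by rewrite /derivn iterD.
Qed.

Lemma iter_Pop_ridge j f : iter j (Pop a) (ridge xi f) = ridge xi (iter j diffop f).
Proof.
elim: j => //= j ->; move: (iter _ _ _) => g; apply/funext => z.
rewrite /Pop /ridge horner_sum; apply: eq_bigr => k _.
by rewrite dmono_ridge /ridge !hornerZ mulrA.
Qed.

(** All derivatives at 0 are bounded at once so that the estimate can be iterated: [diffop] only
    raises orders of derivation and multiplies by fixed coefficients. *)
Lemma horner_diffop_le (B : C) f :
  (forall s, `|f^`(s).[0]| <= B) ->
  forall s, `|(diffop f)^`(s).[0]| <= (\sum_k `|a k * \prod_i xi i ^+ k i|) * B.
Proof.
move=> fB s; rewrite /diffop linear_sum horner_sum /=.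
apply: (le_trans (ler_norm_sum _ _ _)); rewrite big_distrl; apply: ler_sum => k _ /=.
rewrite derivnZ hornerZ normrM ler_wpM2l //.
by rewrite /derivn -iterD; apply: fB.
Qed.

Lemma horner_iter_diffop_le j (B : C) f :
  (forall s, `|f^`(s).[0]| <= B) ->
  forall s, `|(iter j diffop f)^`(s).[0]| <= (\sum_k `|a k * \prod_i xi i ^+ k i|) ^+ j * B.
Proof.
move=> fB; elim: j => [|j IH] s; first by rewrite mul1r.
by rewrite exprS -mulrA; apply: horner_diffop_le.
Qed.

Hypothesis a0 : forall k, a k != 0 -> (0 < \sum_i k i)%N.

(** By [a0], every monomial that occurs differentiates at least once. *)
Lemma size_diffop (f : {poly C}) : (size (diffop f) <= (size f).-1)%N.
Proof.
apply: (leq_trans (size_sum _ _ _)); apply/bigmax_leqP => k _.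
have [->|/a0] := eqVneq (a k) 0; first by rewrite mul0r scale0r size_poly0.
move=> h; apply: (leq_trans (size_scale_leq _ _)).
case: (\sum_i k i)%N h => // s _; rewrite derivSn.
elim: s => [|s IH].
  rewrite derivn0; have [->|f0] := eqVneq f 0; first by rewrite deriv0 size_poly0.
  by have := lt_size_deriv f0; case: (size f).
apply: leq_trans IH; rewrite derivnS.
have [->|f0] := eqVneq (f^`()^`(s)) 0; first by rewrite deriv0.
by rewrite ltnW // lt_size_deriv.
Qed.

(** Consequently the series in the theorem is a finite sum on polynomial ridge functions. *)
Lemma iter_diffop_eq0 j (f : {poly C}) : (size f <= j)%N -> iter j diffop f = 0.
Proof.
move=> fj; apply/eqP; rewrite -size_poly_eq0 -leqn0.
have -> : 0%N = (size f - j)%N by apply/esym/eqP.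
elim: j {fj} => [|j IH] /=; first by rewrite subn0.
by apply: (leq_trans (size_diffop _)); rewrite subnS -!subn1 leq_sub2r.
Qed.

End RidgeOperators.

(** * Polynomial approximations of the exponential *)

(** The polynomial [(1 + X / L) ^ L], given by its coefficients so that its derivatives at 0 can be
    read off. *)
Definition exp_poly (K : numFieldType) (L : nat) : {poly K} :=
  \poly_(s < L.+1) ('C(L, s)%:R / L%:R ^+ s).

Lemma size_exp_poly (K : numFieldType) (L : nat) : (size (exp_poly K L) <= L.+1)%N.
Proof. exact: size_poly. Qed.

Lemma horner_exp_poly (K : numFieldType) (L : nat) (x : K) :
  (exp_poly K L).[x] = (1 + x / L%:R) ^+ L.
Proof.
rewrite addrC exprD1n horner_poly; apply: eq_bigr => s _.
by rewrite -[RHS]mulr_natr exprMn exprVn mulrAC -mulrA mulrC.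
Qed.

Lemma derivn_exp_poly0 (K : numFieldType) (L s : nat) :
  (exp_poly K L)^`(s).[0] = (L ^_ s)%:R / L%:R ^+ s.
Proof.
rewrite horner_coef0 coef_derivn addn0 ffactnn coef_poly ltnS.
case: leqP => [_|Ls]; last by rewrite ffact_small // mul0r mul0rn.
by rewrite -bin_ffact natrM -[LHS]mulr_natr mulrAC.
Qed.

Lemma ffact_leq_expn (L s : nat) : (L ^_ s <= L ^ s)%N.
Proof.
elim: s => // s IH; rewrite ffactnSr expnSr leq_mul //; lia.
Qed.

Lemma derivn_exp_poly0_le1 (K : numFieldType) (L s : nat) :
  `|(exp_poly K L.+1)^`(s).[0]| <= 1.
Proof.
rewrite derivn_exp_poly0 ger0_norm ?divr_ge0 ?exprn_ge0 //.
by rewrite ler_pdivrMr ?exprn_gt0 // mul1r -natrX ler_nat ffact_leq_expn.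
Qed.

(** Passing from [s] to [s + 1] multiplies the derivative by [1 - s / (L + 1)], a loss of at most
    [s / (L + 1)]; the losses add up since [s^2 + s <= (s + 1)^2]. *)
Lemma derivn_exp_poly0_sub1 (K : numFieldType) (L s : nat) :
  `|(exp_poly K L.+1)^`(s).[0] - 1| <= (s ^ 2)%:R / L.+1%:R.
Proof.
have := derivn_exp_poly0_le1 K L s.
rewrite derivn_exp_poly0 ger0_norm ?divr_ge0 ?exprn_ge0 // => h1.
rewrite ler0_norm ?subr_le0 // opprB.
elim: s {h1} => [|s IH]; first by rewrite ffactn0 expr0 divr1 subrr mul0r.
have u1 : (L.+1 ^_ s)%:R / L.+1%:R ^+ s <= 1 :> K.
  by rewrite ler_pdivrMr ?exprn_gt0 // mul1r -natrX ler_nat ffact_leq_expn.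
have L0 : L.+1%:R != 0 :> K by [].
have h : (L.+1 ^_ s)%:R / L.+1%:R ^+ s - (L.+1 ^_ s.+1)%:R / L.+1%:R ^+ s.+1
   <= s%:R / L.+1%:R :> K.
  have [sL|Ls] := leqP s L.+1.
    rewrite ffactnSr natrM natrB // exprS.
    rewrite [X in X <= _](_ : _ = ((L.+1 ^_ s)%:R / L.+1%:R ^+ s) * (s%:R / L.+1%:R)).
      by rewrite -[leRHS]mul1r ler_wpM2r // divr_ge0.
    by field; rewrite expf_neq0 // andbT addrC natr1.
  by rewrite (ffact_small Ls) (ffact_small (leqW Ls)) !mul0r subrr divr_ge0.
rewrite -(subrKA ((L.+1 ^_ s)%:R / L.+1%:R ^+ s)).
apply: (le_trans (lerD IH h)).
rewrite -mulrDl ler_wpM2r ?invr_ge0 // -natrD ler_nat; nia.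
Qed.

(** Gives the convergence of the first coefficient to the symbol [P xi] as [L] grows. *)
Lemma horner_diffop_exp_poly_sub (R : realType) (n p : nat) (xi : 'I_n -> R[i])
    (a : {ffun 'I_n -> 'I_p.+1} -> R[i]) (L : nat) :
  `|(diffop xi a (exp_poly _ L.+1)).[0] - \sum_k a k * \prod_i xi i ^+ k i| <=
  (\sum_k `|a k * \prod_i xi i ^+ k i| * ((\sum_i k i) ^ 2)%:R) / L.+1%:R.
Proof.
rewrite /diffop horner_sum -sumrB big_distrl /=.
apply: (le_trans (ler_norm_sum _ _ _)); apply: ler_sum => k _.
rewrite hornerZ -{2}[a k * _]mulr1 -mulrBr normrM -mulrA ler_wpM2l //.
exact: derivn_exp_poly0_sub1.
Qed.

(** * Boundedness on the imaginary axis *)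

Section ImaginaryAxis.
Variable R : realType.

(** The squared modulus as an element of [R]; the norm of [R[i]] takes its values in [R[i]]. *)
Definition sqnorm (z : R[i]) : R := complex.Re z ^+ 2 + complex.Im z ^+ 2.

Lemma sqnormM (z w : R[i]) : sqnorm (z * w) = sqnorm z * sqnorm w.
Proof. by case: z w => [a b] [c d]; rewrite /sqnorm /=; ring. Qed.

Lemma sqnormX (z : R[i]) k : sqnorm (z ^+ k) = sqnorm z ^+ k.
Proof.
elim: k => [|k IH]; last by rewrite !exprS sqnormM IH.
by rewrite !expr0 /sqnorm /= expr1n expr0n addr0.
Qed.

(** For [1 <= B] one has [B <= B^2], which avoids a square root in the bound. *)
Lemma Re_le_sqnorm (z : R[i]) (B : R) : 1 <= B -> sqnorm z <= B ->
  `|complex.Re z| <= B /\ `|complex.Im z| <= B.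
Proof.
case: z => x y; rewrite /sqnorm /= => B1 h.
have B0 : 0 <= B by apply: le_trans B1.
have := sqr_ge0 x; have := sqr_ge0 y => hy hx.
by split; rewrite -ler_sqr ?nnegrE // real_normK ?num_real //; nra.
Qed.

(** With [l = L + 1]: [|1 + i t / l|^2 = 1 + t^2 / l^2 <= 1 + 1 / l <= exp (1 / l)], then the [l]-th
    power is taken. *)
Lemma sqnorm_exp_poly_imaginary (L : nat) (t : R) : t ^+ 2 <= L.+1%:R ->
  sqnorm (exp_poly _ L.+1).[Complex 0 t] <= expR 1.
Proof.
move=> tL; rewrite horner_exp_poly sqnormX.
have LR0 : (L.+1%:R : R) != 0 by [].
have -> : 1 + Complex 0 t / L.+1%:R = Complex 1 (t / L.+1%:R) :> R[i].
  have -> : (L.+1%:R : R[i]) = (L.+1%:R : R)%:C%C by rewrite rmorph_nat.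
  rewrite -fmorphV /=; apply/eqP; rewrite eq_complex /=; apply/andP; split; apply/eqP; ring.
rewrite /sqnorm /= expr1n.
apply: (@le_trans _ _ (expR (L.+1%:R^-1) ^+ L.+1)).
  apply: lerXn2r; rewrite ?nnegrE ?expR_ge0 //.
    by rewrite addr_ge0 ?sqr_ge0.
  apply: (@le_trans _ _ (1 + L.+1%:R^-1)); last exact: expR_ge1Dx.
  rewrite lerD2l expr_div_n ler_pdivrMr ?exprn_gt0 // expr2 mulrA mulVf // mul1r.
  exact: tL.
by rewrite -expRM_natl mulfV.
Qed.

End ImaginaryAxis.

(** * Integrals of polynomial families *)

Section ComplexIntegral.
Variables (R : realType) (n : nat).
Local Notation C := (R[i]).
Local Notation V := ('rV[R]_n).

(** Continuity by components, the form in which [cintegral] uses its integrand. *)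
Definition continuousC (g : V -> C) : Prop :=
  continuous (fun y => complex.Re (g y) : R) /\ continuous (fun y => complex.Im (g y) : R).

Lemma continuousC_cst (c : C) : continuousC (fun=> c).
Proof. by split=> y; apply: cst_continuous. Qed.

Lemma continuousC_real (f : V -> R) : continuous f -> continuousC (fun y => (f y)%:C%C).
Proof. by move=> cf; split=> //= y; apply: cst_continuous. Qed.

Lemma continuousCD (g h : V -> C) :
  continuousC g -> continuousC h -> continuousC (fun y => g y + h y).
Proof.
move=> [g1 g2] [h1 h2]; split.
  have -> : (fun y => complex.Re (g y + h y)) = (fun y => complex.Re (g y) + complex.Re (h y)).
    by apply/funext => y; case: (g y) (h y) => ? ? [? ?].
  by move=> y; exact: (cvgD (g1 y) (h1 y)).
have -> : (fun y => complex.Im (g y + h y)) = (fun y => complex.Im (g y) + complex.Im (h y)).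
  by apply/funext => y; case: (g y) (h y) => ? ? [? ?].
by move=> y; exact: (cvgD (g2 y) (h2 y)).
Qed.

Lemma continuousCM (g h : V -> C) :
  continuousC g -> continuousC h -> continuousC (fun y => g y * h y).
Proof.
move=> [g1 g2] [h1 h2]; split.
  have -> : (fun y => complex.Re (g y * h y)) =
     (fun y => complex.Re (g y) * complex.Re (h y) - complex.Im (g y) * complex.Im (h y)).
    by apply/funext => y; case: (g y) (h y) => ? ? [? ?].
  move=> y; exact: (cvgB (cvgM (g1 y) (h1 y)) (cvgM (g2 y) (h2 y))).
have -> : (fun y => complex.Im (g y * h y)) =
     (fun y => complex.Re (g y) * complex.Im (h y) + complex.Im (g y) * complex.Re (h y)).
  by apply/funext => y; case: (g y) (h y) => ? ? [? ?].
move=> y; exact: (cvgD (cvgM (g1 y) (h2 y)) (cvgM (g2 y) (h1 y))).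
Qed.

Lemma continuousC_sum (I : Type) (s : seq I) (g : I -> V -> C) :
  (forall i, continuousC (g i)) -> continuousC (fun y => \sum_(i <- s) g i y).
Proof.
move=> cg; elim: s => [|i s IH].
  by under eq_fun do rewrite big_nil; apply: continuousC_cst.
by under eq_fun do rewrite big_cons; apply: continuousCD.
Qed.

Lemma measurable_continuous (f : V -> R) :
  continuous f -> measurable_fun setT (f : BorelRn R n -> R).
Proof.
move=> /continuousP cf mT; apply: (measurability _ (measurable_realfun.RGenOpens.measurableE R)) => //.
move=> _ [_ [a [b ->] <-]]; rewrite setTI.
by apply: sub_sigma_algebra; apply: cf; apply: interval_open.
Qed.

Variable K : set V.
Hypothesis cK : compact K.

Lemma measurable_compact : measurable (K : set (BorelRn R n)).
Proof.
rewrite -[K]setCK; apply: measurableC; apply: sub_sigma_algebra.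
by apply: closed_openC; apply: compact_closed cK; apply: norm_hausdorff.
Qed.

Lemma integrable_continuous (mu : {finite_measure set (BorelRn R n) -> \bar R}) (f : V -> R) :
  continuous f -> mu.-integrable K (EFin \o (f : BorelRn R n -> R)).
Proof.
move=> cf; apply: measurable_bounded_integrable.
- exact: measurable_compact.
- by rewrite ltey_eq fin_num_measure //; apply: measurable_compact.
- by apply: measurable_funTS; apply: measurable_continuous.
have : compact (f @` K).
  by apply: continuous_compact => //; apply: continuous_subspaceT.
move=> /compact_bounded [M [Mr HM]]; exists M; split => // x Mx y Ky.
by apply: HM Mx _ _; exists y.
Qed.

Lemma Rintegral_continuous_le (mu : {finite_measure set (BorelRn R n) -> \bar R})
    (f : V -> R) (B : R) :
  continuous f -> (forall y, K y -> `|f y| <= B) ->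
  `|Rintegral mu K f| <= B * fine (mu K).
Proof.
move=> cf fB; have mK := measurable_compact.
have cn : continuous (fun y => `|f y|) by move=> y; exact: (cvg_norm (cf y)).
have cB : continuous (fun _ : V => B) by move=> y; apply: cst_continuous.
apply: (le_trans (le_normr_Rintegral mK (integrable_continuous mu cf))).
apply: (le_trans (le_Rintegral mK (integrable_continuous mu cn)
  (integrable_continuous mu cB) fB)).
by rewrite Rintegral_cst.
Qed.

Section Linearity.
Variables mu1 mu2 mu3 mu4 : {finite_measure set (BorelRn R n) -> \bar R}.
Local Notation I := (cintegral mu1 mu2 mu3 mu4 K).

Lemma cintegralD (g h : V -> C) : continuousC g -> continuousC h ->
  I (fun y => g y + h y) = I g + I h.
Proof.
move=> [g1 g2] [h1 h2]; rewrite /cintegral.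
have E1 (mu : {finite_measure set (BorelRn R n) -> \bar R}) :
  Rintegral mu K (fun y => complex.Re (g y + h y)) =
  Rintegral mu K (fun y => complex.Re (g y)) + Rintegral mu K (fun y => complex.Re (h y)).
  rewrite -(RintegralD measurable_compact (integrable_continuous mu g1) (integrable_continuous mu h1)).
  by apply: eq_Rintegral => y _; case: (g y) (h y) => ? ? [? ?].
have E2 (mu : {finite_measure set (BorelRn R n) -> \bar R}) :
  Rintegral mu K (fun y => complex.Im (g y + h y)) =
  Rintegral mu K (fun y => complex.Im (g y)) + Rintegral mu K (fun y => complex.Im (h y)).
  rewrite -(RintegralD measurable_compact (integrable_continuous mu g2) (integrable_continuous mu h2)).
  by apply: eq_Rintegral => y _; case: (g y) (h y) => ? ? [? ?].
by rewrite !E1 !E2; apply/eqP; rewrite eq_complex /=; apply/andP; split; apply/eqP; ring.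
Qed.

Lemma cintegralZ (c : C) (g : V -> C) : continuousC g -> I (fun y => c * g y) = c * I g.
Proof.
case: c => a b [g1 g2]; rewrite /cintegral.
have cZ r (f : V -> R) : continuous f -> continuous (fun y => r * f y).
  by move=> cf y; apply: (@cvgM _ _ _ _ (cst r) f _ _ _ (cf y)); apply: cst_continuous.
have E1 (mu : {finite_measure set (BorelRn R n) -> \bar R}) :
  Rintegral mu K (fun y => complex.Re (Complex a b * g y)) =
  a * Rintegral mu K (fun y => complex.Re (g y)) - b * Rintegral mu K (fun y => complex.Im (g y)).
  rewrite -mulNr -(RintegralZl _ measurable_compact (integrable_continuous mu g1)).
  rewrite -(RintegralZl _ measurable_compact (integrable_continuous mu g2)).
  rewrite -(RintegralD measurable_compact (integrable_continuous mu (cZ _ _ g1)) (integrable_continuous mu (cZ _ _ g2))).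
  by apply: eq_Rintegral => y _; case: (g y) => u v /=; rewrite mulNr.
have E2 (mu : {finite_measure set (BorelRn R n) -> \bar R}) :
  Rintegral mu K (fun y => complex.Im (Complex a b * g y)) =
  a * Rintegral mu K (fun y => complex.Im (g y)) + b * Rintegral mu K (fun y => complex.Re (g y)).
  rewrite -(RintegralZl _ measurable_compact (integrable_continuous mu g1)).
  rewrite -(RintegralZl _ measurable_compact (integrable_continuous mu g2)).
  rewrite -(RintegralD measurable_compact (integrable_continuous mu (cZ _ _ g2)) (integrable_continuous mu (cZ _ _ g1))).
  by apply: eq_Rintegral => y _; case: (g y) => u v.
by rewrite !E1 !E2; apply/eqP; rewrite eq_complex /=; apply/andP; split; apply/eqP; ring.
Qed.

Lemma cintegral_sum (D : nat) (c : nat -> C) (g : nat -> V -> C) :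
  (forall d, continuousC (g d)) ->
  I (fun y => \sum_(d < D) c d * g d y) = \sum_(d < D) c d * I (g d).
Proof.
move=> cg; elim: D => [|D IH].
  (* The zero integrand is written [0 * 0] so that homogeneity yields the value 0. *)
  rewrite big_ord0; under [X in cintegral _ _ _ _ _ X]eq_fun do rewrite big_ord0 -(mul0r 0).
  by rewrite cintegralZ ?mul0r //; apply: continuousC_cst.
under [X in cintegral _ _ _ _ _ X]eq_fun do rewrite big_ord_recr /=.
rewrite big_ord_recr /= cintegralD ?IH.
- by rewrite cintegralZ.
- apply: continuousC_sum => d; apply: continuousCM => //; exact: continuousC_cst.
- by apply: continuousCM => //; apply: continuousC_cst.
Qed.

Lemma cintegral_le (g : V -> C) (B : R) : continuousC g ->
  (forall y, K y -> `|complex.Re (g y)| <= B /\ `|complex.Im (g y)| <= B) ->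
  `|complex.Re (I g)| <= B * (fine (mu1 K) + fine (mu2 K) + fine (mu3 K) + fine (mu4 K)) /\
  `|complex.Im (I g)| <= B * (fine (mu1 K) + fine (mu2 K) + fine (mu3 K) + fine (mu4 K)).
Proof.
move=> [g1 g2] gB; rewrite /cintegral /=.
have N4 (a b c d : R) : `|a + b + c + d| <= `|a| + `|b| + `|c| + `|d|.
  apply: (le_trans (ler_normD _ _)); rewrite lerD2r.
  by apply: (le_trans (ler_normD _ _)); rewrite lerD2r ler_normD.
have A1 mu := Rintegral_continuous_le mu g1 (fun y Ky => proj1 (gB y Ky)).
have A2 mu := Rintegral_continuous_le mu g2 (fun y Ky => proj2 (gB y Ky)).
by rewrite !mulrDr; split; apply: (le_trans (N4 _ _ _ _)); rewrite ?normrN !lerD ?A1 ?A2.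
Qed.

(* Families [t |-> (Q y).[t]] of polynomials in t with coefficients depending
   continuously on y and degree bounded uniformly in y. *)
Definition continuous_poly (Q : V -> {poly C}) : Prop :=
  (exists D, forall y, (size (Q y) <= D)%N) /\ forall d, continuousC (fun y => (Q y)`_d).

Lemma continuous_polyC (c : V -> C) : continuousC c -> continuous_poly (fun y => (c y)%:P).
Proof.
move=> cc; split; first by exists 1 => y; rewrite size_polyC leq_b1.
move=> d; under eq_fun do rewrite coefC.
by case: eqP => _ //; apply: continuousC_cst.
Qed.

Lemma continuous_polyXn (k : nat) : continuous_poly (fun=> 'X^k).
Proof.
split; first by exists k.+1 => y; rewrite size_polyXn.
by move=> d; apply: continuousC_cst.
Qed.

Lemma continuous_polyD (Q1 Q2 : V -> {poly C}) : continuous_poly Q1 -> continuous_poly Q2 ->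
  continuous_poly (fun y => Q1 y + Q2 y).
Proof.
move=> [[D1 H1] c1] [[D2 H2] c2]; split.
  exists (maxn D1 D2) => y; apply: (leq_trans (size_polyD _ _)).
  by rewrite geq_max !leq_max H1 H2 orbT.
by move=> d; under eq_fun do rewrite coefD; apply: continuousCD.
Qed.

Lemma continuous_polyM (Q1 Q2 : V -> {poly C}) : continuous_poly Q1 -> continuous_poly Q2 ->
  continuous_poly (fun y => Q1 y * Q2 y).
Proof.
move=> [[D1 H1] c1] [[D2 H2] c2]; split.
  exists (D1 + D2)%N => y; apply: (leq_trans (size_polyMleq _ _)).
  by apply: (leq_trans (leq_pred _)); apply: leq_add.
move=> d; under eq_fun do rewrite coefM.
by apply: continuousC_sum => i; apply: continuousCM.
Qed.

Lemma continuous_polyX (Q : V -> {poly C}) k : continuous_poly Q ->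
  continuous_poly (fun y => Q y ^+ k).
Proof.
move=> cQ; elim: k => [|k IH].
  exact: (continuous_polyC (continuousC_cst 1)).
by under eq_fun do rewrite exprS; apply: continuous_polyM.
Qed.

Lemma continuous_poly_sum (J : Type) (s : seq J) (Q : J -> V -> {poly C}) :
  (forall i, continuous_poly (Q i)) -> continuous_poly (fun y => \sum_(i <- s) Q i y).
Proof.
move=> cQ; elim: s => [|i s IH].
  by under eq_fun do rewrite big_nil; apply: (continuous_polyC (continuousC_cst 0)).
by under eq_fun do rewrite big_cons; apply: continuous_polyD.
Qed.

Lemma continuousC_horner (Q : V -> {poly C}) t : continuous_poly Q ->
  continuousC (fun y => (Q y).[t]).
Proof.
move=> [[D sQ] cQ]; under eq_fun do rewrite (horner_coef_wide _ (sQ _)).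
by apply: continuousC_sum => i; apply: continuousCM => //; apply: continuousC_cst.
Qed.

(** The uniform degree bound allows integration coefficient by coefficient. *)
Lemma cintegral_poly (Q : V -> {poly C}) : continuous_poly Q ->
  exists q : {poly C}, forall t, I (fun y => (Q y).[t]) = q.[t].
Proof.
move=> [[D sQ] cQ]; exists (\poly_(d < D) I (fun y => (Q y)`_d)) => t.
rewrite horner_poly.
under [X in cintegral _ _ _ _ _ X]eq_fun => y.
  rewrite (horner_coef_wide _ (sQ _)).
  under eq_bigr do rewrite mulrC.
  over.
rewrite (cintegral_sum _ (fun d => t ^+ d) cQ).
by apply: eq_bigr => d _; rewrite mulrC.
Qed.

End Linearity.
End ComplexIntegral.

(** * Integral means of ridge functions *)

Lemma cvg_unique_complex (R : rcfType) (u : nat -> R[i]^o) (x y : R[i]^o) :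
  u @ \oo --> x -> u @ \oo --> y -> x = y.
Proof. exact: (cvg_unique (@norm_hausdorff _ (R[i]^o : normedModType R[i]))). Qed.

(** A nonzero difference would have too many roots among the distinct points [d / (k + 2)]. *)
Lemma eq_poly_near0 (R : rcfType) (q1 q2 : {poly R[i]}) (d : R) : 0 < d ->
  (forall t : R, `|t| < d -> q1.[t%:C%C] = q2.[t%:C%C]) -> q1 = q2.
Proof.
move=> d0 H; apply/eqP; rewrite -subr_eq0; apply: contraT => q0.
pose u (k : nat) : R := d / k.+2%:R.
have := @max_poly_roots _ (q1 - q2) [seq (u k)%:C%C | k <- iota 0 (size (q1 - q2)%R)] q0.
rewrite size_map size_iota ltnn => F; apply: F.
  apply/allP => _ /mapP[k _ ->]; rewrite /root hornerD hornerN subr_eq0; apply/eqP.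
  apply: H; rewrite ger0_norm ?divr_ge0 ?ltW // /u ltr_pdivrMr //.
  by rewrite ltr_pMr // ltr1n.
rewrite map_inj_uniq ?iota_uniq // => i j /complexI /(mulfI (lt0r_neq0 d0)) /invr_inj /eqP.
by rewrite eqr_nat => /eqP [].
Qed.

(** The [p]-th root of [s] is at most the larger of 1 and [s], whence the bound [1 + S]. *)
Lemma exists_exprn_eq (R : realType) (p : nat) (s S : R) : (0 < p)%N -> 0 <= s <= S ->
  exists2 t : R, 0 <= t <= 1 + S & t ^+ p = s.
Proof.
move=> p0 /andP[s0 sS]; exists (s `^ (p%:R^-1)).
  rewrite powR_ge0 /=; have [s1|s1] := leP s 1.
    apply: (@le_trans _ _ (1 `^ (p%:R^-1))); first by apply: ge0_ler_powR; rewrite ?nnegrE.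
    by rewrite powR1 lerDl (le_trans s0).
  apply: (@le_trans _ _ (s `^ 1)); last by rewrite powRr1 //; lra.
  apply: ler_powR; first exact: ltW.
  by rewrite invf_le1 ?ltr0n // ler1n.
by rewrite -powR_mulrn ?powR_ge0 // -powRrM mulVf ?powRr1 // pnatr_eq0 -lt0n.
Qed.

Section RidgeMean.
Variables (R : realType) (n : nat) (N : 'I_n -> nat).
Local Notation C := (R[i]).
Variables (mu1 mu2 mu3 mu4 : {finite_measure set (BorelRn R n) -> \bar R}).
Variable K : set 'rV[R]_n.
Hypothesis cK : compact K.

Lemma holomorphic_ridge (xi : 'I_n -> C) f : holomorphic_near0 (ridge xi f).
Proof. by exists setT; split; [exact: openT|split=> // z _; exact: differentiable_ridge]. Qed.

(** [<xi, t^N y>] is a polynomial in [t] with terms [xi_i y_i t^(N_i)]; composing with [f] keeps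
    this form. *)
Lemma continuous_poly_ridge (xi : 'I_n -> C) (f : {poly C}) :
  exists2 Q : 'rV[R]_n -> {poly C}, continuous_poly Q &
    forall y t, (Q y).[t%:C%C] = ridge xi f (0 + tN N t y).
Proof.
pose P (y : 'rV[R]_n) : {poly C} := \sum_i (xi i * (y 0 i)%:C%C)%:P * 'X^(N i).
exists (fun y => \sum_(d < size f) (f`_d)%:P * P y ^+ d).
  apply: continuous_poly_sum => d.
  apply: (continuous_polyM (Q1 := fun=> (f`_d)%:P)).
    exact: (continuous_polyC (continuousC_cst _ _)).
  apply: continuous_polyX; apply: continuous_poly_sum => i.
  apply: (continuous_polyM (Q1 := fun y => (xi i * (y 0 i)%:C%C)%:P) (Q2 := fun=> 'X^(N i))).
    apply: continuous_polyC; apply: continuousCM; first exact: continuousC_cst.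
    by apply: continuousC_real; apply: coord_continuous.
  exact: continuous_polyXn.
move=> y t.
have PE : (P y).[t%:C%C] = linform xi (0 + tN N t y).
  rewrite horner_sum; apply: eq_bigr => i _.
  by rewrite hornerCM hornerXn !mxE add0r rmorphM rmorphXn /= mulrAC mulrA.
rewrite /ridge [in RHS]horner_coef horner_sum; apply: eq_bigr => d _.
by rewrite hornerCM horner_exp PE.
Qed.

Lemma gen_mean_ridge_poly (xi : 'I_n -> C) (f : {poly C}) :
  exists q : {poly C}, forall t,
    gen_mean N mu1 mu2 mu3 mu4 K (ridge xi f) 0 t = q.[t%:C%C].
Proof.
have [Q cQ QE] := continuous_poly_ridge xi f.
have [q qE] := cintegral_poly cK mu1 mu2 mu3 mu4 cQ.
exists q => t; rewrite -qE /gen_mean; congr cintegral.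
by apply/funext => y; rewrite QE.
Qed.

Lemma gen_mean_ridge_le (xi : 'I_n -> C) (f : {poly C}) (t B : R) :
  (forall y, K y -> `|complex.Re (ridge xi f (0 + tN N t y))| <= B /\
                    `|complex.Im (ridge xi f (0 + tN N t y))| <= B) ->
  `|complex.Re (gen_mean N mu1 mu2 mu3 mu4 K (ridge xi f) 0 t)| <=
     B * (fine (mu1 K) + fine (mu2 K) + fine (mu3 K) + fine (mu4 K)) /\
  `|complex.Im (gen_mean N mu1 mu2 mu3 mu4 K (ridge xi f) 0 t)| <=
     B * (fine (mu1 K) + fine (mu2 K) + fine (mu3 K) + fine (mu4 K)).
Proof.
have [Q cQ QE] := continuous_poly_ridge xi f => H.
apply: cintegral_le => //.
have -> : (fun y => ridge xi f (0 + tN N t y)) = (fun y => (Q y).[t%:C%C]).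
  by apply/funext => y; rewrite QE.
exact: continuousC_horner.
Qed.

Lemma linform0 (F : numFieldType) (xi : 'I_n -> F) : linform xi 0 = 0.
Proof. by rewrite /linform big1 // => i _; rewrite mxE mulr0. Qed.

Lemma series_term_ridge (p : nat) (a : {ffun 'I_n -> 'I_p.+1} -> C) (m : nat -> R)
    (xi : 'I_n -> C) f t j :
  series_term a m (ridge xi f) 0 t j =
  (iter j (diffop xi a) f).[0] / (m j)%:C%C * t%:C%C ^+ (p * j).
Proof. by rewrite /series_term iter_Pop_ridge /ridge linform0. Qed.

(** Both sides are polynomials in [t], so the identity known for [|t| < d] propagates to every real
    [t]. *)
Lemma gen_mean_ridgeE (p : nat) (a : {ffun 'I_n -> 'I_p.+1} -> C) (m : nat -> R)
    (xi : 'I_n -> C) (f : {poly C}) (d : R) (D : nat) :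
  (forall k, a k != 0 -> (0 < \sum_i k i)%N) ->
  0 < d ->
  (forall t : R, `|t| < d ->
    (fun M => \sum_(0 <= j < M) series_term a m (ridge xi f) 0 t j : R[i]^o) @ \oo
      --> (gen_mean N mu1 mu2 mu3 mu4 K (ridge xi f) 0 t : R[i]^o)) ->
  (size f <= D)%N ->
  forall t, gen_mean N mu1 mu2 mu3 mu4 K (ridge xi f) 0 t =
    \sum_(0 <= j < D) (iter j (diffop xi a) f).[0] / (m j)%:C%C * t%:C%C ^+ (p * j).
Proof.
move=> a0 d0 Hcvg fD t.
have [q qE] := gen_mean_ridge_poly xi f.
pose q' : {poly C} := \sum_(0 <= j < D) ((iter j (diffop xi a) f).[0] / (m j)%:C%C) *: 'X^(p * j).
have q'E s : q'.[s] = \sum_(0 <= j < D) (iter j (diffop xi a) f).[0] / (m j)%:C%C * s ^+ (p * j).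
  by rewrite horner_sum; apply: eq_bigr => j _; rewrite hornerZ hornerXn.
rewrite qE -q'E; congr (_.[_]); apply: eq_poly_near0 d0 _ => s sd.
rewrite -qE q'E.
have Hc : (fun M => \sum_(0 <= j < M) series_term a m (ridge xi f) 0 s j : R[i]^o) @ \oo
   --> (\sum_(0 <= j < D) (iter j (diffop xi a) f).[0] / (m j)%:C%C * s%:C%C ^+ (p * j) : R[i]^o).
  (* The partial sums are constant from [D] on, since the later iterates vanish. *)
  apply: cvg_near_cst.
  near=> M.
  have DM : (D <= M)%N by near: M; exact: nbhs_infty_ge.
  rewrite (@big_cat_nat _ _ _ D 0 M) //= [X in _ + X]big_nat_cond [X in _ + X]big1 ?addr0.
    by apply: eq_bigr => j _; rewrite series_term_ridge.
  move=> j /andP[/andP[Dj _] _].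
  rewrite series_term_ridge iter_diffop_eq0 ?horner0 ?mul0r //.
  exact: leq_trans Dj.
move: (Hcvg s sd) Hc; set u := (fun M : nat => _); move: u (gen_mean _ _ _ _ _ _ _ _ _) (\sum_(0 <= j < D) _).
exact: cvg_unique_complex.
Unshelve. all: by end_near. Qed.

End RidgeMean.

(** * Uniform bound and choice of the test functions *)

Lemma linform_imaginary (R : realType) (n : nat) (N : 'I_n -> nat) (eta : 'I_n -> nat)
    (t : R) (y : 'rV[R]_n) :
  linform (fun i => Complex 0 (eta i)%:R) (0 + tN N t y) =
  Complex 0 (\sum_i (eta i)%:R * (t ^+ N i * y 0 i)).
Proof.
rewrite /linform; set T := fun i => (eta i)%:R * (t ^+ N i * y 0 i).
have -> : Complex 0 (\sum_i T i) = 'i%C * (\sum_i T i)%:C%C.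
  by apply/eqP; rewrite eq_complex /=; apply/andP; split; apply/eqP; ring.
rewrite rmorph_sum big_distrr; apply: eq_bigr => i _ /=; rewrite !mxE add0r /T.
by apply/eqP; rewrite eq_complex /=; apply/andP; split; apply/eqP; ring.
Qed.

Lemma compact_coord_bounded (R : realType) (n : nat) (K : set 'rV[R]_n) :
  compact K -> exists2 Y : R, 0 <= Y & forall y i, K y -> `|y 0 i| <= Y.
Proof.
move=> /compact_bounded [M [Mr HM]].
exists (`|M| + 1) => [|y i Ky]; first by rewrite addr_ge0.
have M1 : M < `|M| + 1 by rewrite (le_lt_trans (ler_norm M)) // ltrDl.
apply: le_trans (HM _ M1 y Ky).
by rewrite /Num.norm /= mx_normrE; apply: (le_bigmax _ (fun ij : 'I_1 * 'I_n => `|y ij.1 ij.2|) (0, i)).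
Qed.

Lemma exp_ridge_bound (R : realType) (n : nat) (N : 'I_n -> nat) (eta : 'I_n -> nat)
    (K : set 'rV[R]_n) (T : R) : compact K -> 0 <= T ->
  exists L0, forall L, (L0 <= L)%N -> forall t y, 0 <= t <= T -> K y ->
    sqnorm (ridge (fun i => Complex 0 (eta i)%:R) (exp_poly _ L.+1) (0 + tN N t y)) <= expR 1.
Proof.
move=> /compact_coord_bounded [Y Y0 HY] T0.
(* [Th] bounds [|<eta, t^N y>|] for [0 <= t <= T] and [y] in [K]; the estimate on the imaginary axis
   applies once [Th^2 <= L + 1]. *)
pose Th : R := \sum_i (eta i)%:R * (T ^+ N i * Y).
have Th0 : 0 <= Th.
  by apply: sumr_ge0 => i _; rewrite mulr_ge0 // mulr_ge0 // exprn_ge0.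
exists (Num.truncn (Th ^+ 2)) => L hL t y /andP[t0 tT] Ky.
rewrite /ridge linform_imaginary; apply: sqnorm_exp_poly_imaginary.
apply: (@le_trans _ _ (Th ^+ 2)); last first.
  apply: ltW; apply: lt_le_trans (truncnS_gt _) _.
  by rewrite ler_nat ltnS.
rewrite -[leLHS]real_normK ?num_real // lerXn2r ?nnegrE //.
apply: (le_trans (ler_norm_sum _ _ _)); apply: ler_sum => i _.
rewrite !normrM normr_nat ler_wpM2l // normrX (ger0_norm t0).
apply: ler_pM; rewrite ?exprn_ge0 //; last exact: HY.
by rewrite lerXn2r ?nnegrE.
Qed.

(** The powers [i^|k|] are absorbed into the coefficients, which reduces to natural points. *)
Lemma exists_imaginary_nonzero (R : realType) (n p : nat)
    (a : {ffun 'I_n -> 'I_p.+1} -> R[i]) k0 : a k0 != 0 ->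
  exists eta : 'I_n -> nat,
    \sum_k a k * \prod_i (Complex 0 (eta i)%:R : R[i]) ^+ k i != 0.
Proof.
move=> ak0.
have i0 : 'i%C != 0 :> R[i] by rewrite eq_complex /= oner_eq0 andbF.
have := @exists_nat_nonzero _ _ _ (fun k : {ffun 'I_n -> 'I_p.+1} => a k * 'i%C ^+ (\sum_i k i)) k0.
rewrite mulf_neq0 ?expf_neq0 // => /(_ isT) [eta Heta].
exists eta; apply: contraNneq Heta => h; apply/eqP; rewrite -[RHS]h; apply: eq_bigr => k _.
rewrite -mulrA; congr (_ * _); rewrite -prodrXr -big_split /=; apply: eq_bigr => i _.
rewrite -exprMn; congr (_ ^+ _).
have -> : ((eta i)%:R : R[i]) = ((eta i)%:R : R)%:C%C by rewrite rmorph_nat.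
by apply/eqP; rewrite eq_complex /=; apply/andP; split; apply/eqP; ring.
Qed.

(** * Real parts of products with a conjugate *)

Lemma complexReD (R : rcfType) (z w : R[i]) :
  complex.Re (z + w) = complex.Re z + complex.Re w.
Proof. by case: z w => a b [c d]. Qed.

Lemma complexRe_sum (R : rcfType) (I : Type) (s : seq I) (F : I -> R[i]) :
  complex.Re (\sum_(i <- s) F i) = \sum_(i <- s) complex.Re (F i).
Proof. exact: (big_morph _ (@complexReD R)). Qed.

Lemma Re_mul_conj (R : rcfType) (w z : R[i]) :
  complex.Re (w^*%C * z) = complex.Re w * complex.Re z + complex.Im w * complex.Im z.
Proof. by case: w z => a b [c d] /=; ring. Qed.

(** Cauchy-Schwarz in the plane; [complex.Re] turns the norms into elements of [R]. *)
Lemma Re_mul_conj_le (R : rcfType) (w z : R[i]) :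
  `|complex.Re (w^*%C * z)| <= complex.Re `|w| * complex.Re `|z|.
Proof.
have ReN (x : R[i]) : `|x| = (complex.Re `|x|)%:C%C by rewrite RRe_real // normr_real.
rewrite -lecR rmorphM /= -!ReN; apply: (le_trans (normc_ge_Re _)).
by rewrite normrM normcJ.
Qed.

Lemma Re_mul_conj_self (R : rcfType) (w : R[i]) :
  complex.Re (w^*%C * w) = complex.Re `|w| ^+ 2.
Proof.
have ReN (x : R[i]) : `|x| = (complex.Re `|x|)%:C%C by rewrite RRe_real // normr_real.
by apply: complexI; rewrite rmorphXn /= -ReN mulrC -sqr_normc RRe_real // realX // normr_real.
Qed.

(** * Contradiction from a representing measure *)

Theorem theorem4 (R : realType) (n : nat) (N : 'I_n -> nat) (p : nat)
  (a : {ffun 'I_n -> 'I_p.+1} -> R[i]) (m : nat -> R) :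
  (1 <= n)%N -> (forall i, (0 < N i)%N) -> (2 < p)%N ->
  quasi_homogeneous N a -> order_fun p m ->
  ~ exists (mu1 mu2 mu3 mu4 : {finite_measure set (BorelRn R n) -> \bar R})
           (K : set 'rV[R]_n),
      [/\ compact K,
          [/\ mu1 (~` K) = 0%E, mu2 (~` K) = 0%E, mu3 (~` K) = 0%E & mu4 (~` K) = 0%E] &
          forall phi : 'rV[R[i]]_n -> R[i], holomorphic_near0 phi ->
            exists2 d : R, 0 < d &
              forall (z : 'rV[R[i]]_n) (t : R), `|z| < d%:C%C -> `|t| < d ->
                (fun M => \sum_(0 <= j < M) series_term a m phi z t j : R[i]^o) @ \oo
                  --> (gen_mean N mu1 mu2 mu3 mu4 K phi z t : R[i]^o)].
Proof.
move=> _ _ p2 [[k0 ak0] aN] [c [Cc [c0 [_ hm]]]] [mu1 [mu2 [mu3 [mu4 [K [cK _ H]]]]]].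
have [eta w0] := exists_imaginary_nonzero ak0.
set xi := fun i => (Complex 0 (eta i)%:R : R[i]) in w0.
set w := \sum_k _ in w0.
(* The zero multi-index has weight 0, which differs from [p]. *)
have ka k : a k != 0 -> (0 < \sum_i k i)%N.
  move=> /aN pE; rewrite lt0n; apply/eqP => k_eq0.
  move: p2; rewrite -pE big1 // => i _.
  by move/eqP: k_eq0; rewrite sum_nat_eq0 => /forallP/(_ i)/= /eqP ->.
pose b L j := (iter j (diffop xi a) (exp_poly _ L.+1)).[0].
(* Pairing with the conjugate of [w] makes the coefficients real, while [r L 1] still tends to
   [|w|^2 / m 1], a positive number. *)
pose r L j := complex.Re (w^*%C * b L j) / m j.
pose v := complex.Re `|w|.
have v0 : 0 < v.
  rewrite -ltcR /v RRe_real ?normr_real // normr_gt0; exact: w0.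
pose W := complex.Re (\sum_k `|a k * \prod_i xi i ^+ k i|).
have WE : \sum_k `|a k * \prod_i xi i ^+ k i| = W%:C%C.
  by rewrite /W RRe_real // ger0_real // sumr_ge0.
have W0 : 0 <= W by rewrite -ler0c -WE sumr_ge0.
have m0 j : 0 < m j.
  apply: lt_le_trans (proj1 (hm j)).
  by rewrite mulr_gt0 ?exprn_gt0 // ltr0n fact_gt0.
(* Combines [|b L j| <= W^j] with [m j >= c^j (p j)! >= c^j (3 j)!]; the last inequality is where
   [p > 2] enters. *)
have rle L j : `|r L j| <= v * (W / c) ^+ j / (3 * j)`!%:R.
  have f0 k : 0 < k`!%:R :> R by rewrite ltr0n fact_gt0.
  rewrite /r normrM (gtr0_norm (x := (m j)^-1)) ?invr_gt0 //.
  have h1 : `|complex.Re (w^*%C * b L j)| <= v * W ^+ j.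
    apply: (le_trans (Re_mul_conj_le _ _)); rewrite ler_wpM2l ?(ltW v0) //.
    rewrite -lecR RRe_real ?normr_real // rmorphXn /= -WE -[leRHS]mulr1.
    have := @horner_iter_diffop_le R n p xi a j 1 (exp_poly _ L.+1) _ 0%N.
    by rewrite derivn0; apply => s; apply: derivn_exp_poly0_le1.
  apply: (@le_trans _ _ (v * W ^+ j / m j)); first by rewrite ler_wpM2r // invr_ge0 ltW.
  rewrite expr_div_n [v * (_ / _)]mulrA -[leRHS]mulrA -invfM ler_wpM2l ?mulr_ge0 ?exprn_ge0 ?(ltW v0) //.
  have h3 : c ^+ j * (3 * j)`!%:R <= m j.
    apply: le_trans (proj1 (hm j)); rewrite ler_pM2l ?exprn_gt0 // ler_nat.
    by apply: leq_fact; rewrite leq_mul2r p2 orbT.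
  by rewrite lef_pV2 // posrE ?mulr_gt0 ?exprn_gt0.
pose mass := fine (mu1 K) + fine (mu2 K) + fine (mu3 K) + fine (mu4 K).
(* This bound depends on none of [L], [S] and [t]. *)
pose M := (`|complex.Re w| + `|complex.Im w|) * (expR 1 * mass).
have bounded S : exists L0, forall L, (L0 <= L)%N -> exists D0, forall D, (D0 <= D)%N ->
     forall s, 0 <= s <= S -> `|\sum_(0 <= j < D) r L j * s ^+ j| <= M.
  have [S0|S0] := leP 0 S; last first.
    by exists 0%N => L _; exists 0%N => D _ s /andP[s0 /(le_trans s0)]; rewrite leNgt S0.
  have S1 : 0 <= 1 + S by rewrite addr_ge0.
  have [L0 HL] := exp_ridge_bound N eta cK S1.
  (* [L.+2] bounds the size of [exp_poly _ L.+1], so sums of this length contain every nonzero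
     term. *)
  exists L0 => L LL; exists L.+2 => D LD s s0S.
  have [t t0T ts] := exists_exprn_eq (ltnW (ltnW p2)) s0S.
  (* The radius [d] may depend on [L] and be smaller than [t]; [gen_mean_ridgeE] removes the
     restriction. *)
  have [d d0 Hd] := H _ (holomorphic_ridge xi (exp_poly _ L.+1)).
  have z0 : `|0 : 'rV[R[i]]_n| < d%:C%C by rewrite normr0 ltcR.
  have GE := gen_mean_ridgeE cK ka d0
     (fun t' => Hd 0 t' z0)
     (leq_trans (size_exp_poly _ L.+1) LD).
  have e1 : 1 <= expR 1 :> R by rewrite -[leLHS]expR0 ler_expR.
  have [GR GI] := @gen_mean_ridge_le _ _ N mu1 mu2 mu3 mu4 _ cK xi (exp_poly _ L.+1) t (expR 1)
    (fun y Ky => Re_le_sqnorm e1 (HL _ LL _ _ t0T Ky)).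
  have -> : \sum_(0 <= j < D) r L j * s ^+ j =
     complex.Re (w^*%C * gen_mean N mu1 mu2 mu3 mu4 K (ridge xi (exp_poly _ L.+1)) 0 t).
    rewrite GE big_distrr complexRe_sum /=.
    apply: eq_bigr => j _; rewrite -/(b L j) /r -ts -exprM.
    have -> : w^*%C * (b L j / (m j)%:C%C * t%:C%C ^+ (p * j)) =
       (w^*%C * b L j) * ((m j)^-1 * t ^+ (p * j))%:C%C.
      by rewrite rmorphM fmorphV rmorphXn /= !mulrA.
    rewrite -mulrA; case: (w^*%C * b L j) => u1 u2 /=; ring.
  rewrite Re_mul_conj; apply: (le_trans (ler_normD _ _)); rewrite /M mulrDl !normrM.
  by apply: lerD; rewrite ler_wpM2l.
pose A := complex.Re (\sum_k `|a k * \prod_i xi i ^+ k i| * ((\sum_i k i) ^ 2)%:R).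
have AE : \sum_k `|a k * \prod_i xi i ^+ k i| * ((\sum_i k i) ^ 2)%:R = A%:C%C.
  by rewrite /A RRe_real // ger0_real // sumr_ge0 // => k _; rewrite mulr_ge0.
have A0 : 0 <= A by rewrite -ler0c -AE sumr_ge0 // => k _; rewrite mulr_ge0.
(* Half of the lower bound [v^2 / (2 m 1)] obtained below for [r L 1]. *)
have e0 : 0 < v ^+ 2 / (4 * m 1%N) by rewrite divr_gt0 ?exprn_gt0 // mulr_gt0.
have [L0 HL] := linear_coef_cvg0 (ltW v0) (divr_ge0 W0 (ltW c0)) rle bounded e0.
pose L := maxn L0 (Num.truncn (2 * A / v)).
have /HL : (L0 <= L)%N by apply: leq_maxl.
have hL : A / L.+1%:R <= v / 2.
  have : 2 * A / v < L.+1%:R.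
    apply: lt_le_trans (truncnS_gt _) _; rewrite ler_nat ltnS; exact: leq_maxr.
  rewrite ltr_pdivrMr // ler_pdivrMr // => h; lra.
have hb : complex.Re `|b L 1%N - w| <= v / 2.
  apply: le_trans hL; rewrite -lecR RRe_real ?normr_real //.
  rewrite rmorphM fmorphV /= rmorph_nat -AE.
  exact: horner_diffop_exp_poly_sub.
(* Splitting [b L 1] as [w] plus an error of modulus at most [v / 2] gives at least
   [v^2 - v * (v / 2)]. *)
have : v ^+ 2 / 2 <= complex.Re (w^*%C * b L 1%N).
  have -> : b L 1%N = w + (b L 1%N - w) by rewrite addrC subrK.
  rewrite mulrDr complexReD /= Re_mul_conj_self -/v.
  have h2 : `|complex.Re (w^*%C * (b L 1%N - w))| <= v * (v / 2).
    by apply: (le_trans (Re_mul_conj_le _ _)); rewrite ler_wpM2l ?(ltW v0).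
  move: h2; rewrite ler_norml => /andP[h2 _].
  by rewrite expr2; lra.
move=> h3 /(le_trans (ler_norm _)); rewrite /r leNgt => /negP; apply.
apply: (@lt_le_trans _ _ (v ^+ 2 / 2 / m 1%N)); last by rewrite ler_pM2r // invr_gt0.
rewrite invfM mulrA ltr_pM2r ?invr_gt0 // ltr_pM2l ?exprn_gt0 //; lra.
Qed.
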